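(* Let $3\le k\le\lfloor n/2\rfloor$ and let $G_{k\times n}=[\mathbb{1}_k\,|\,A]$, with $A=(a_{i,j})\in GF(q)^{k\times(n-k)}$, be a generator matrix in standard form of an MDS code $[n,k,n-k+1]_q$. Let $G_{\widehat{k-1},\widehat{k}}=[\mathbb{1}_{k-2}\,|\,A_{(k-2)\times(n-k)}]$ be the $(k-2)\times(n-2)$ matrix obtained from $G_{k\times n}$ by deleting its $(k-1)$-th and $k$-th rows and columns, and let $$|\psi_{00}\rangle=\sum_{\vec v\in GF(q)^{k-2}}|\vec v\,G_{\widehat{k-1},\widehat{k}}\rangle\in(\mathbb{C}^q)^{\otimes(n-2)}.$$ Define the Pauli strings $$M_1=\underbrace{\mathbb{1}\otimes\cdots\otimes\mathbb{1}}_{k-2}\otimes X^{a_{k-1,1}}\otimes\cdots\otimes X^{a_{k-1,n-k}},\qquad M_2=\underbrace{\mathbb{1}\otimes\cdots\otimes\mathbb{1}}_{k-2}\otimes X^{a_{k,1}}\otimes\cdots\otimes X^{a_{k,n-k}},$$ and put $$|\psi_{m_1,m_2}\rangle=M_1^{m_1}M_2^{m_2}|\psi_{00}\rangle,\qquad 0\le m_1,m_2\le q-1 .$$ Then the states $|\psi_{m_1,m_2}\rangle$ are mutually orthogonal $(k-2)$-uniform states, and the subspace $\mathcal{C}=\operatorname{span}\{|\psi_{m_1,m_2}\rangle : 0\le m_1,m_2\le q-1\}\subset(\mathbb{C}^q)^{\otimes(n-2)}$ is a quantum error correcting code with parameters $[\![n-2,2,k-1]\!]_q$.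
   Context: **Classical codes.** A linear code $[n,k,d_H]_q$ is a $k$-dimensional subspace of $GF(q)^n$ with minimum Hamming distance $d_H$; it is MDS if $d_H=n-k+1$. **Pauli operators.** $X|j\rangle=|j+1 \bmod q\rangle$ and $Z|j\rangle=\omega^j|j\rangle$ with $\omega=e^{2\pi i/q}$, where $|j\rangle$ are the computational basis states of $\mathbb{C}^q$. A Pauli string is a tensor product of powers of these operators; the exponents above are elements of $GF(q)$ (for $q$ prime, integers mod $q$), and $M_i^{m}$ is the $m$-th power of $M_i$. For a vector $w$ over $GF(q)$, $|w\rangle=|w_1\rangle\otimes|w_2\rangle\otimes\cdots$. States are understood up to normalization. **Uniform states.** A pure state of several qudits of dimension $q$ is $r$-uniform if its reduced density matrix on every set of at most $r$ parties is proportional to the identity. **Quantum codes.** The weight $\operatorname{wt}(W)$ of an operator $W$ is the number of tensor factors on which it acts non-trivially. A subspace $\mathcal{C}\subset(\mathbb{C}^q)^{\otimes N}$ of dimension $q^{\tilde k}$ with orthonormal basis $\{|\psi_m\rangle\}$ is a quantum error correcting code with parameters $[\![N,\tilde k,d]\!]_q$ if $\langle\psi_m|E^\dagger F|\psi_{m'}\rangle=f(E^\dagger F)\,\delta_{m,m'}$ for all $m,m'$ and all errors $E,F$ with $\operatorname{wt}(E^\dagger F)<d$ (where $f$ does not depend on $m$), $d$ being the distance of the code: the minimal weight of an operator $W$ for which $\langle\psi|W|\psi'\rangle\neq0$ for some $\psi,\psi'\in\mathcal{C}$ with $\langle\psi|\psi'\rangle=0$. *)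

(* Defs.v *)
From HB Require Import structures.
From mathcomp Require Import all_boot all_order all_algebra.
From mathcomp Require Import boolp.

Set Implicit Arguments.
Unset Strict Implicit.
Unset Printing Implicit Defensive.

Import Order.TTheory GRing.Theory Num.Theory.
Local Open Scope ring_scope.

(** * Classical codes *)

Definition hamming_dist (F : finFieldType) (n : nat) (u v : 'rV[F]_n) : nat :=
  #|[set i | u 0 i != v 0 i]|.

(* The code generated by [G] is the row space of [G]. *)
Definition min_hamming_dist (F : finFieldType) (m n : nat)
    (G : 'M[F]_(m, n)) (d : nat) : Prop :=
  (exists u v : 'rV[F]_n,
      [/\ (u <= G)%MS, (v <= G)%MS, u != v & hamming_dist u v = d]) /\
  (forall u v : 'rV[F]_n,
      (u <= G)%MS -> (v <= G)%MS -> u != v -> (d <= hamming_dist u v)%N).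

(* [G] is a generator matrix (its rows form a basis) of an [n, k, d] code. *)
Definition generates_code (F : finFieldType) (m l : nat) (G : 'M[F]_(m, l))
    (n k d : nat) : Prop :=
  [/\ l = n, row_free G, \rank G = k & min_hamming_dist G d].

Definition generates_MDS (F : finFieldType) (m l : nat) (G : 'M[F]_(m, l))
    (n k : nat) : Prop :=
  generates_code G n k (n - k + 1).

(** * Hilbert spaces with a computational basis *)

(* [hilb C I] is C^I with computational basis |x>, x : I.  One qudit is
   [hilb C F] (levels labelled by GF(q)); N qudits, i.e. (C^q)^(tensor N), are
   [hilb C 'rV[F]_N], where the basis vector [ket w] stands for
   |w_1> (x) ... (x) |w_N>. *)
Notation hilb C I := {ffun I -> C^o}.
Notation qudits C F N := (hilb C 'rV[F]_N).

Definition ket (C : numClosedFieldType) (I : finType) (x : I) : hilb C I :=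
  [ffun y => (y == x)%:R].

(* <phi|psi>, antilinear in the first argument *)
Definition dot (C : numClosedFieldType) (I : finType) (phi psi : hilb C I) : C :=
  \sum_x (phi x)^* * psi x.

(* <x|W|y> *)
Definition elt (C : numClosedFieldType) (I : finType)
    (W : 'End(hilb C I)) (x y : I) : C := dot (ket C x) (W (ket C y)).

Definition apply_kernel (C : numClosedFieldType) (I : finType)
    (K : I -> I -> C) (psi : hilb C I) : hilb C I :=
  [ffun x => \sum_y K x y * psi y].

Lemma apply_kernel_is_linear (C : numClosedFieldType) (I : finType)
  (K : I -> I -> C) : linear (apply_kernel K).
Proof.
move=> a u v; apply/ffunP => x; rewrite !ffunE.
rewrite scaler_sumr -big_split /=; apply: eq_bigr => y _.
by rewrite !ffunE mulrDr; congr (_ + _); rewrite /GRing.scale /= mulrCA.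
Qed.

HB.instance Definition _ (C : numClosedFieldType) (I : finType)
  (K : I -> I -> C) := GRing.isLinear.Build C (hilb C I) (hilb C I) _
    (apply_kernel K) (apply_kernel_is_linear K).

(* The operator with prescribed matrix elements, see [elt_op]. *)
Definition op (C : numClosedFieldType) (I : finType) (K : I -> I -> C) :
  'End(hilb C I) := linfun (apply_kernel K).

Lemma opE (C : numClosedFieldType) (I : finType) (K : I -> I -> C) psi x :
  op K psi x = \sum_y K x y * psi y.
Proof. by rewrite lfunE /= ffunE. Qed.

Lemma dot_ket (C : numClosedFieldType) (I : finType) (x : I) (psi : hilb C I) :
  dot (ket C x) psi = psi x.
Proof.
rewrite /dot (bigD1 x) //= ffunE eqxx rmorph1 mul1r big1 ?addr0 // => y yx.
by rewrite ffunE (negPf yx) rmorph0 mul0r.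
Qed.

Lemma op_ket (C : numClosedFieldType) (I : finType) (K : I -> I -> C) x y :
  op K (ket C y) x = K x y.
Proof.
rewrite opE (bigD1 y) //= ffunE eqxx mulr1 big1 ?addr0 // => z zy.
by rewrite ffunE (negPf zy) mulr0.
Qed.

Lemma elt_op (C : numClosedFieldType) (I : finType) (K : I -> I -> C) x y :
  elt (op K) x y = K x y.
Proof. by rewrite /elt dot_ket op_ket. Qed.

Definition adjoint (C : numClosedFieldType) (I : finType)
    (W : 'End(hilb C I)) : 'End(hilb C I) := op (fun x y => (elt W y x)^*).

(* T_1 (x) ... (x) T_N *)
Definition tensor_op (C : numClosedFieldType) (F : finFieldType) (N : nat)
    (T : 'I_N -> 'End(hilb C F)) : 'End(qudits C F N) :=
  op (fun v w : 'rV[F]_N => \prod_i elt (T i) (v 0 i) (w 0 i)).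

(** * Pauli X strings *)

(* X^a for a in GF(q): |j> |-> |j + a>.  In particular X = X^1 and, for prime q,
   X^a is the a-th power of X = (|j> |-> |j + 1 mod q>): see
   [shiftX_iter]. *)
Definition shiftX (C : numClosedFieldType) (F : finFieldType) (a : F) :
  'End(hilb C F) := op (fun i j => (i == j + a)%:R).

(* X^(w_1) (x) ... (x) X^(w_N).  The power of this string with exponent m in
   GF(q) is [pauliX C (m *: w)], which is the usual m-th power when m is (the
   image of) an integer: see [pauliX_iter].  For prime q this is the case of
   every m in GF(q). *)
Definition pauliX (C : numClosedFieldType) (F : finFieldType) (N : nat)
    (w : 'rV[F]_N) : 'End(qudits C F N) :=
  tensor_op (fun i => shiftX C (w 0 i)).

Lemma shiftXE (C : numClosedFieldType) (F : finFieldType) (a : F) psi i :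
  shiftX C a psi i = psi (i - a).
Proof.
rewrite opE (bigD1 (i - a)) //= subrK eqxx mul1r big1 ?addr0 // => j ji.
by rewrite -[i == _]subr_eq eq_sym (negPf ji) mul0r.
Qed.

Lemma shiftX_iter (C : numClosedFieldType) (F : finFieldType) (m : nat) psi :
  shiftX C (m%:R : F) psi = iter m (shiftX C 1) psi.
Proof.
elim: m => [|m IH] /=; apply/ffunP => i; first by rewrite shiftXE subr0.
by rewrite !shiftXE -IH shiftXE -addrA -opprD nat1r.
Qed.

Lemma pauliXE (C : numClosedFieldType) (F : finFieldType) (N : nat)
  (w : 'rV[F]_N) psi v : pauliX C w psi v = psi (v - w).
Proof.
rewrite opE (bigD1 (v - w)) //= [X in X * _]big1 => [|i _]; last first.
  by rewrite elt_op !mxE subrK eqxx.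
rewrite mul1r big1 ?addr0 // => u uvw.
suff [i Hi]: exists i, v 0 i != u 0 i + w 0 i.
  by rewrite (bigD1 i) //= elt_op (negPf Hi) !mul0r.
apply/existsP; rewrite -negb_forall; apply: contra uvw => /forallP H.
by apply/eqP/rowP => i; rewrite !mxE (eqP (H i)) addrK.
Qed.

Lemma pauliX_iter (C : numClosedFieldType) (F : finFieldType) (N m : nat)
  (w : 'rV[F]_N) psi :
  pauliX C ((m%:R : F) *: w) psi = iter m (pauliX C w) psi.
Proof.
elim: m => [|m IH] /=; apply/ffunP => v.
  by rewrite pauliXE scale0r subr0.
by rewrite !pauliXE -IH pauliXE -addrA -opprD -nat1r scalerDl scale1r.
Qed.

(** * Uniform states *)

Definition restrict (F : finFieldType) (N : nat) (S : {set 'I_N})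
    (v : 'rV[F]_N) : 'rV[F]_#|S| := \row_i v 0 (enum_val i).

(* Matrix elements <x|rho_S|y> of rho_S = Tr_(~: S) |psi><psi| (up to the
   normalization of psi): the sum runs over the pairs of basis states that
   restrict to x and y on S and agree on the traced-out parties. *)
Definition reduced_density (C : numClosedFieldType) (F : finFieldType) (N : nat)
    (psi : qudits C F N) (S : {set 'I_N}) (x y : 'rV[F]_#|S|) : C :=
  \sum_(v | restrict S v == x)
    \sum_(w | (restrict S w == y) && (restrict (~: S) w == restrict (~: S) v))
      psi v * (psi w)^*.

Definition uniform_state (C : numClosedFieldType) (F : finFieldType) (N : nat)
    (psi : qudits C F N) (r : nat) : Prop :=
  psi != 0 /\
  forall S : {set 'I_N}, (#|S| <= r)%N ->
    exists c : C, forall x y : 'rV[F]_#|S|,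
      reduced_density psi x y = c * (x == y)%:R.

(** * Quantum codes *)

(* W = 1 (x) W', with the identity on the i-th tensor factor. *)
Definition acts_trivially (C : numClosedFieldType) (F : finFieldType) (N : nat)
    (W : 'End(qudits C F N)) (i : 'I_N) : Prop :=
  exists W' : 'End(qudits C F N.-1), forall v w : 'rV[F]_N,
    elt W v w = (v 0 i == w 0 i)%:R * elt W' (col' i v) (col' i w).

Definition wt (C : numClosedFieldType) (F : finFieldType) (N : nat)
    (W : 'End(qudits C F N)) : nat := #|[set i | ~~ `[< acts_trivially W i >]]|.

Definition maps_orthogonal (C : numClosedFieldType) (F : finFieldType) (N : nat)
    (Q : {vspace qudits C F N}) (W : 'End(qudits C F N)) : Prop :=
  exists psi psi' : qudits C F N,
    [/\ psi \in Q, psi' \in Q, dot psi psi' = 0 & dot psi (W psi') != 0].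

Definition quantum_distance (C : numClosedFieldType) (F : finFieldType) (N : nat)
    (Q : {vspace qudits C F N}) (d : nat) : Prop :=
  (exists W, maps_orthogonal Q W /\ wt W = d) /\
  (forall W, maps_orthogonal Q W -> (d <= wt W)%N).

Definition orthonormal_basis (C : numClosedFieldType) (I : finType) (D : nat)
    (Q : {vspace hilb C I}) (b : 'I_D -> hilb C I) : Prop :=
  (forall m m', dot (b m) (b m') = (m == m')%:R) /\ <<codom b>>%VS = Q.

(* Q is a quantum error correcting code with parameters [[n, kt, d]]_q. *)
Definition qecc (C : numClosedFieldType) (F : finFieldType) (N : nat)
    (Q : {vspace qudits C F N}) (n kt d : nat) : Prop :=
  [/\ N = n,
      \dim Q = (#|F| ^ kt)%N,
      (exists b : 'I_(#|F| ^ kt) -> qudits C F N,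
         orthonormal_basis Q b /\
         exists f : 'End(qudits C F N) -> C,
           forall E E' : 'End(qudits C F N),
             (wt (adjoint E \o E')%VF < d)%N ->
             forall m m', dot (b m) ((adjoint E \o E')%VF (b m')) =
                          f (adjoint E \o E')%VF * (m == m')%:R)
    & quantum_distance Q d].

(** * The code states *)

(* The row (resp. column) indices of [1_k | A] that survive the deletion of the
   last two rows (resp. of the last two columns of the identity block). *)
Definition kept_row (k : nat) : 'I_(k - 2) -> 'I_k := widen_ord (leq_subr 2 k).

Definition kept_col (k l : nat) (j : 'I_((k - 2) + l)) : 'I_(k + l) :=
  match split j with
  | inl j1 => lshift l (kept_row j1)
  | inr j2 => rshift k j2
  end.

Definition G_hat (F : finFieldType) (k l : nat) (G : 'M[F]_(k, k + l)) :
  'M[F]_(k - 2, (k - 2) + l) := mxsub (@kept_row k) (@kept_col k l) G.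

Lemma G_hat_standard (F : finFieldType) (k l : nat) (A : 'M[F]_(k, l)) :
  G_hat (row_mx 1%:M A) = row_mx 1%:M (rowsub (@kept_row k) A).
Proof.
apply/matrixP => i j; rewrite [LHS]mxE [RHS]mxE /kept_col.
by case: (split j) => j'; rewrite ?row_mxEl ?row_mxEr !mxE.
Qed.

Definition psi00 (C : numClosedFieldType) (F : finFieldType) (k l : nat)
    (A : 'M[F]_(k, l)) : qudits C F ((k - 2) + l) :=
  \sum_(v : 'rV[F]_(k - 2)) ket C (v *m G_hat (row_mx 1%:M A)).

(* Exponents of 1 (x) ... (x) 1 (x) X^(a_(r,1)) (x) ... (x) X^(a_(r,l)). *)
Definition M_exponents (F : finFieldType) (k l : nat) (A : 'M[F]_(k, l))
    (r : 'I_k) : 'rV[F]_((k - 2) + l) := row_mx 0 (row r A).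

(* M_1^(m1) M_2^(m2) |psi_00>, where M_1, M_2 come from rows r1, r2 of A *)
Definition code_state (C : numClosedFieldType) (F : finFieldType) (k l : nat)
    (A : 'M[F]_(k, l)) (r1 r2 : 'I_k) (m1 m2 : F) : qudits C F ((k - 2) + l) :=
  pauliX C (m1 *: M_exponents A r1)
    (pauliX C (m2 *: M_exponents A r2) (psi00 C A)).

(* Main.v *)
Require Import Defs.
From mathcomp Require Import all_boot all_order all_algebra.
From mathcomp Require Import boolp ring zify.

Set Implicit Arguments.
Unset Strict Implicit.
Unset Printing Implicit Defensive.

Import Order.TTheory GRing.Theory Num.Theory.
Local Open Scope ring_scope.

(* |psi_m> is the indicator of the coset D_m of the punctured code, where D_m
   consists of the x = (u, (u, m) A).  The MDS property gives two facts.  Points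
   of D_m and D_m' differ in at least n - k + 1 places, minus one for each
   coordinate in which m and m' differ.  The code D_0 takes every value on any
   set S of at most k - 2 coordinates, so D_m and D_m' are translates of each
   other by vectors vanishing on S.  Hence, for wt W < k - 1, the matrix elements
   <x|W|y> between points of the cosets vanish unless x = y and m = m', and the
   remaining sum of the <x|W|x> over D_m is independent of m: this is the
   Knill-Laflamme condition, and the same two facts give uniformity.  The
   distance is attained by a diagonal projector on k - 1 coordinates. *)

(** * Inner products, matrix elements and indicator states *)

Section Dot.
Variables (C : numClosedFieldType) (I : finType).
Implicit Types (p q : hilb C I) (W : 'End(hilb C I)).

Lemma dot_suml (J : finType) (a : J -> C) (f : J -> hilb C I) q :
  dot (\sum_j a j *: f j) q = \sum_j (a j)^* * dot (f j) q.
Proof.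
under [RHS]eq_bigr do rewrite mulr_sumr.
rewrite exchange_big; apply: eq_bigr => x _.
rewrite sum_ffunE rmorph_sum mulr_suml; apply: eq_bigr => j _.
by rewrite ffunE rmorphM mulrA.
Qed.

Lemma dot_sumr (J : finType) (a : J -> C) (f : J -> hilb C I) p :
  dot p (\sum_j a j *: f j) = \sum_j a j * dot p (f j).
Proof.
under [RHS]eq_bigr do rewrite mulr_sumr.
rewrite exchange_big; apply: eq_bigr => x _.
rewrite sum_ffunE mulr_sumr; apply: eq_bigr => j _.
by rewrite ffunE mulrCA.
Qed.

Lemma dot_lfun_sumr (J : finType) (a : J -> C) (f : J -> hilb C I) p W :
  dot p (W (\sum_j a j *: f j)) = \sum_j a j * dot p (W (f j)).
Proof.
rewrite linear_sum -dot_sumr; congr dot; apply: eq_bigr => j _; exact: linearZ.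
Qed.

Lemma dotZl a p q : dot (a *: p) q = a^* * dot p q.
Proof.
by rewrite /dot mulr_sumr; apply: eq_bigr => x _; rewrite ffunE rmorphM mulrA.
Qed.

Lemma dotZr a p q : dot p (a *: q) = a * dot p q.
Proof.
by rewrite /dot mulr_sumr; apply: eq_bigr => x _; rewrite ffunE mulrCA.
Qed.

Lemma dotDl p p' q : dot (p + p') q = dot p q + dot p' q.
Proof.
by rewrite -big_split; apply: eq_bigr => x _; rewrite ffunE rmorphD mulrDl.
Qed.

Lemma dotBr p q q' : dot p (q - q') = dot p q - dot p q'.
Proof.
by rewrite -sumrB; apply: eq_bigr => x _; rewrite !ffunE mulrDr mulrN.
Qed.

Lemma ket_expansion p : p = \sum_x p x *: ket C x.
Proof.
apply/ffunP => x; rewrite sum_ffunE (bigD1 x) //= big1 => [|y yx].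
  by rewrite !ffunE eqxx addr0 [RHS]mulr1.
by rewrite !ffunE eq_sym (negPf yx) [LHS]mulr0.
Qed.

Lemma lfun_elt W p x : W p x = \sum_y elt W x y * p y.
Proof.
rewrite {1}[p]ket_expansion linear_sum sum_ffunE; apply: eq_bigr => y _.
by rewrite linearZ ffunE /elt dot_ket mulrC.
Qed.

Lemma mem_span_family (J : finType) (f : J -> hilb C I) p :
  p \in <<[seq f j | j : J]>>%VS -> exists a, p = \sum_j a j *: f j.
Proof.
rewrite span_def big_map big_enum => /memv_sumP[v vP ->].
have {vP} /fin_all_exists[a aP] j : exists a, v j = a *: f j.
  by have /vlineP := vP j isT.
by exists a; apply: eq_bigr => j _.
Qed.

(** Left unnormalized, so that inner products of such states count points. *)
Definition indic (D : {set I}) : hilb C I := [ffun x => (x \in D)%:R].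

Lemma dot_indic D q : dot (indic D) q = \sum_(x in D) q x.
Proof.
rewrite [RHS]big_mkcond; apply: eq_bigr => x _; rewrite ffunE rmorph_nat.
by case: (x \in D); rewrite ?mul1r ?mul0r.
Qed.

Lemma dot_indic_card (D D' : {set I}) :
  dot (indic D) (indic D') = #|D :&: D'|%:R.
Proof.
rewrite dot_indic -sum1_card natr_sum.
under eq_bigl do rewrite inE.
by rewrite [RHS]big_mkcondr; apply: eq_bigr => x _; rewrite ffunE; case: ifP.
Qed.

Lemma dot_indic_lfun W (D D' : {set I}) :
  dot (indic D) (W (indic D')) = \sum_(x in D) \sum_(y in D') elt W x y.
Proof.
rewrite dot_indic; apply: eq_bigr => x _; rewrite lfun_elt [RHS]big_mkcond.
by apply: eq_bigr => y _; rewrite ffunE; case: ifP; rewrite ?mulr1 ?mulr0.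
Qed.

End Dot.

(** * Matrix elements of operators of small weight *)

Section Weight.
Variables (C : numClosedFieldType) (F : finFieldType) (N : nat).
Implicit Types (W : 'End(qudits C F N)) (v w : 'rV[F]_N).

Definition supp W : {set 'I_N} := [set i | ~~ `[< acts_trivially W i >]].

Lemma hamming_dist_gt_out v w (S : {set 'I_N}) :
  (#|S| < hamming_dist v w)%N -> exists2 i, i \notin S & v 0 i != w 0 i.
Proof.
move=> lt_S; have : ~~ ([set i | v 0 i != w 0 i] \subset S).
  by apply: contraL lt_S => /subset_leq_card; rewrite -leqNgt.
by case/subsetPn => i; rewrite inE; exists i.
Qed.

(** The labels [v] and [w] differ at some coordinate outside the support, where [W] contributes a
    vanishing Kronecker delta. *)
Lemma elt_far_eq0 W v w : (wt W < hamming_dist v w)%N -> elt W v w = 0.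
Proof.
move=> /hamming_dist_gt_out[i]; rewrite inE negbK => /asboolP[W' W'E] vw.
by rewrite W'E (negPf vw) mul0r.
Qed.

(** Induction on the Hamming distance: overwriting one coordinate of [v] outside the support by that
    of [v'] keeps the diagonal element, since there [W] factors through [col']. *)
Lemma elt_diag_supp W v v' :
  (forall i, i \in supp W -> v 0 i = v' 0 i) -> elt W v v = elt W v' v'.
Proof.
have [d] := ubnP (hamming_dist v v'); elim: d v => // d IH v lt_d eq_v.
have [/eqP|] := eqVneq (hamming_dist v v') 0%N.
  rewrite cards_eq0 => /eqP d0; congr (elt W _ _); apply/rowP => i;
  by have := in_set0 i; rewrite -d0 inE => /negbFE/eqP.
rewrite cards_eq0 => /set0Pn[i]; rewrite inE => vi.
have : i \notin supp W by apply: contra vi => /eq_v->.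
rewrite inE negbK => /asboolP[W' W'E].
pose u : 'rV[F]_N := \row_j if j == i then v' 0 i else v 0 j.
have <- : elt W u u = elt W v v.
  rewrite !W'E !eqxx; congr (_ * elt W' _ _);
  by apply/rowP => j; rewrite !mxE eq_sym (negPf (neq_lift _ _)).
apply: IH => [|j jS]; last first.
  by rewrite mxE; case: eqP => [->//|_]; exact: eq_v.
rewrite ltnS in lt_d; apply: leq_trans lt_d.
  apply: proper_card; apply/properP; split.
  by apply/subsetP => j; rewrite !inE !mxE; case: (j =P i) => // ->; rewrite eqxx.
by exists i; rewrite !inE // mxE !eqxx.
Qed.

Lemma sum_elt_diag_shift W (D D' : {set 'rV[F]_N}) (t : 'rV[F]_N) :
  (forall i, i \in supp W -> t 0 i = 0) ->
  (forall x, (x + t \in D') = (x \in D)) ->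
  \sum_(x in D') elt W x x = \sum_(x in D) elt W x x.
Proof.
move=> t0 DD'; rewrite (reindex_inj (addIr t)) /=.
apply: eq_big => [x|x _]; first exact: DD'.
by apply: elt_diag_supp => i /t0 ti; rewrite mxE ti addr0.
Qed.

End Weight.

Lemma hamming_distxx (F : finFieldType) N (x : 'rV[F]_N) : hamming_dist x x = 0%N.
Proof. by apply/eqP; rewrite cards_eq0; apply/eqP/setP => i; rewrite !inE eqxx. Qed.

(** * The quantum code spanned by indicator states of far-apart translates *)

Section IndicatorCode.
Variables (C : numClosedFieldType) (F : finFieldType) (N kt d : nat).
Variables (M : finType) (D : M -> {set 'rV[F]_N}).
Hypothesis d_gt0 : (0 < d)%N.
Hypothesis card_M : #|M| = (#|F| ^ kt)%N.
Hypothesis D_neq0 : forall m, D m != set0.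
Hypothesis D_far : forall m m' x y, x \in D m -> y \in D m' ->
  (x, m) != (y, m') -> (d <= hamming_dist x y)%N.
Hypothesis D_shift : forall m m' (S : {set 'I_N}), (#|S| < d)%N ->
  exists2 t : 'rV[F]_N, forall i, i \in S -> t 0 i = 0 &
    forall x, (x + t \in D m') = (x \in D m).

Local Notation st m := (indic C (D m)).
Local Notation Q := (<<[seq st m | m : M]>>%VS).

(** A common point of the two sets would have distance 0 < [d] to itself. *)
Lemma indic_orthogonal m m' : m != m' -> dot (st m) (st m') = 0.
Proof.
move=> mm'; rewrite dot_indic_card (_ : _ :&: _ = set0) ?cards0 //.
apply/setP => x; rewrite !inE; apply/negP => /andP[xm xm'].
have := D_far xm xm'; rewrite xpair_eqE eqxx mm' => /(_ isT).
by rewrite hamming_distxx leqNgt d_gt0.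
Qed.

Lemma card_indic m m' : #|D m'| = #|D m|.
Proof.
have [|t _ tP] := @D_shift m m' set0; first by rewrite cards0.
rewrite -!sum1_card (reindex_inj (addIr t)) /=; exact: eq_bigl.
Qed.

(** Distinct points are at distance at least [d], beyond the weight of [W], so only diagonal
    elements survive. A translation vanishing on the support of [W] moves their sum from [D m] to
    the reference set [D m0]. *)
Lemma knill_laflamme W m0 m m' : (wt W < d)%N ->
  dot (st m) (W (st m')) = (m == m')%:R * \sum_(x in D m0) elt W x x.
Proof.
move=> Wd; rewrite dot_indic_lfun; have [<-|mm'] := eqVneq m m'; last first.
  rewrite mul0r big1 // => x xm; rewrite big1 // => y ym'.
  apply/elt_far_eq0/(leq_trans Wd)/(D_far xm ym').
  by rewrite xpair_eqE (negPf mm') andbF.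
have [t tS tP] := @D_shift m0 m _ Wd.
rewrite mul1r -(sum_elt_diag_shift tS tP); apply: eq_bigr => x xm.
rewrite (bigD1 x) //= big1 ?addr0 // => y /andP[ym yx].
apply/elt_far_eq0/(leq_trans Wd)/(D_far xm ym).
by rewrite xpair_eqE eq_sym (negPf yx).
Qed.

(** An operator of weight below [d] compresses to a scalar on [Q], hence cannot connect orthogonal
    states. *)
Lemma indic_distance_ge W : maps_orthogonal Q W -> (d <= wt W)%N.
Proof.
move=> [p [p' [/mem_span_family[a ->] /mem_span_family[a' ->] pp']]].
apply: contraR; rewrite -ltnNge => Wd.
(* Without any reference index [m0], all sums over [M] are empty. *)
have [m0 _|M0] := pickP (@predT M); last first.
  by rewrite dot_suml big1 // => m; have := M0 m.
have nz : (#|D m0|%:R : C) != 0 by rewrite pnatr_eq0 cards_eq0.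
have -> : dot (\sum_m a m *: st m) (W (\sum_m a' m *: st m)) =
    (\sum_(x in D m0) elt W x x) / #|D m0|%:R *
    dot (\sum_m a m *: st m) (\sum_m a' m *: st m); last by rewrite pp' mulr0.
rewrite !dot_suml mulr_sumr; apply: eq_bigr => m _.
rewrite dot_lfun_sumr dot_sumr !mulr_sumr; apply: eq_bigr => m' _.
rewrite (knill_laflamme m0) //.
have -> : dot (st m) (st m') = (m == m')%:R * #|D m0|%:R.
  have [<-|/indic_orthogonal->] := eqVneq m m'; last by rewrite mul0r.
  by rewrite dot_indic_card setIid mul1r (card_indic m0 m).
rewrite [RHS]mulrCA; congr (_ * _); rewrite [RHS]mulrCA; congr (_ * _).
by rewrite mulrCA divfK // mulrC.
Qed.

(** An upper bound on the weight of one operator suffices for the distance, because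
    [indic_distance_ge] gives the matching lower bound. *)
Lemma qecc_indic :
  (exists2 W, maps_orthogonal Q W & (wt W <= d)%N) -> qecc Q N kt d.
Proof.
move=> [W0 W0Q W0d].
pose h (i : 'I_(#|F| ^ kt)) : M := enum_val (cast_ord (esym card_M) i).
have h_inj : injective h by move=> i j /enum_val_inj/cast_ord_inj.
have h_surj m : exists i, m = h i.
  exists (cast_ord card_M (enum_rank m)).
  by rewrite /h cast_ordK enum_rankK.
have kt_gt0 : (0 < #|F| ^ kt)%N 
  by rewrite expn_gt0; apply/orP; left; apply/card_gt0P; exists 0.
pose m0 := h (Ordinal kt_gt0).
have nu_gt0 : (#|D m0|%:R : C) > 0 by rewrite ltr0n card_gt0.
(* All sets [D m] have the same size, so a single constant normalizes every state. *)
pose c : C := sqrtC #|D m0|%:R.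
have c_neq0 : c != 0 by rewrite sqrtC_eq0 gt_eqF.
have cc : (c^-1)^* * c^-1 = (#|D m0|%:R)^-1.
  have c_ge0 : 0 <= c^-1 by rewrite invr_ge0 sqrtC_ge0 ltW.
  by rewrite (CrealP (ger0_real c_ge0)) -expr2 exprVn sqrtCK.
pose b i := c^-1 *: st (h i).
have b_orth i j : dot (b i) (b j) = (i == j)%:R.
  rewrite dotZl dotZr mulrA cc; have [<-|ij] := eqVneq i j.
    by rewrite dot_indic_card setIid (card_indic m0) mulVf ?gt_eqF.
  by rewrite indic_orthogonal ?mulr0 // (inj_eq h_inj).
have b_span : <<codom b>>%VS = Q.
  apply/eqP; rewrite eqEsubv; apply/andP; split; apply/span_subvP => p.
    by case/codomP => i ->; apply/memvZ/memv_span/image_f.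
  case/codomP => m ->; have [i ->] := h_surj m.
  have -> : st (h i) = c *: b i by rewrite scalerA divff ?scale1r.
  by apply/memvZ/memv_span/codom_f.
split=> //.
(* The dimension follows from freeness: pairing a vanishing combination with [b i] isolates its
   coefficient. *)
- rewrite -b_span; pose X := [tuple b i | i < (#|F| ^ kt)%N].
  have -> : codom b = X by rewrite /= /codom /image_mem.
  apply/eqP; suff : free X by rewrite /free size_tuple.
  apply/freeP => a; under eq_bigr do rewrite -tnth_nth tnth_mktuple.
  move=> a0 i; have := dot_sumr a b (b i).
  rewrite a0 (bigD1 i) //= big1 => [|j ji]; last first.
    by rewrite b_orth eq_sym (negPf ji) mulr0.
  rewrite b_orth eqxx mulr1 addr0 => <-.
  by rewrite /dot big1 // => x _; rewrite [X in _ * X]ffunE mulr0.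
- exists b; split => //.
  exists (fun W => (#|D m0|%:R)^-1 * \sum_(x in D m0) elt W x x).
  move=> E E' Wd m m'; rewrite linearZ dotZl dotZr mulrA cc (knill_laflamme m0) //.
  by rewrite (inj_eq h_inj) mulrCA mulrC.
- split; last exact: indic_distance_ge.
  exists W0; split=> //; apply/eqP; rewrite eqn_leq W0d /=.
  exact: indic_distance_ge.
Qed.

End IndicatorCode.

(** * Restriction to a set of parties and uniformity of indicator states *)

Section Restriction.
Variables (F : finFieldType) (N : nat).
Implicit Types (S : {set 'I_N}) (v w : 'rV[F]_N).

Lemma restrictP S v w :
  restrict S v = restrict S w <-> {in S, forall i, v 0 i = w 0 i}.
Proof.
split=> [vw i iS | vw]; last by apply/rowP => j; rewrite !mxE vw ?enum_valP.
by have /rowP/(_ (enum_rank_in iS i)) := vw; rewrite !mxE enum_rankK_in.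
Qed.

Lemma restrictD S v w : restrict S (v + w) = restrict S v + restrict S w.
Proof. by apply/rowP => j; rewrite !mxE. Qed.

Lemma restrict_surj S (x : 'rV[F]_#|S|) : exists v, restrict S v = x.
Proof.
exists (\sum_j x 0 j *: delta_mx 0 (enum_val j)); apply/rowP => i.
rewrite mxE summxE (bigD1 i) //= big1 => [|j ji]; rewrite !mxE !eqxx.
  by rewrite mulr1 addr0.
by rewrite (inj_eq enum_val_inj) eq_sym (negPf ji) mulr0.
Qed.

Lemma hamming_dist_restrict S v w :
  restrict S v = restrict S w -> (hamming_dist v w <= #|~: S|)%N.
Proof.
move/restrictP => vw; apply/subset_leq_card/subsetP => i.
by rewrite !inE; apply: contraNN => /vw ->.
Qed.

(** Points of [D] agreeing off [S] are at distance at most [r], hence equal, which kills the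
    off-diagonal entries. The entry at [x] counts the points of [D] restricting to [x]; translating
    by [t] matches them with those restricting to 0. *)
Lemma uniform_indic (C : numClosedFieldType) (D : {set 'rV[F]_N}) r :
  D != set0 ->
  {in D &, forall x y, x != y -> (r < hamming_dist x y)%N} ->
  (forall S (x : 'rV[F]_#|S|), (#|S| <= r)%N ->
    exists2 t, restrict S t = x & forall v, (v + t \in D) = (v \in D)) ->
  uniform_state (indic C D) r.
Proof.
move=> D0 D_far D_shift; split.
  have [x xD] := set0Pn _ D0; apply/eqP => /ffunP/(_ x).
  by rewrite !ffunE xD => /eqP; rewrite oner_eq0.
move=> S Sr; exists (#|[set v in D | restrict S v == 0]|%:R) => x y.
have [<-|xy] := eqVneq x y; last first.
  rewrite mulr0 [LHS]big1 // => v /eqP vx; rewrite big1 // => w.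
  case/andP=> /eqP wy /eqP wv; rewrite !ffunE rmorph_nat.
  have [vD|] := boolP (v \in D); last by rewrite mul0r.
  have [wD|] := boolP (w \in D); last by rewrite mulr0.
  have vw : v != w by apply: contraNneq xy => vw; rewrite -vx -wy vw.
  have := leq_trans (D_far _ _ vD wD vw) (hamming_dist_restrict (esym wv)).
  by rewrite setCK ltnNge Sr.
rewrite mulr1; have [t tx tD] := D_shift S x Sr.
transitivity (\sum_(v | restrict S v == x) ((v \in D)%:R : C)).
  apply: eq_bigr => v /eqP vx; rewrite (bigD1 v) /= ?vx ?eqxx // big1.
    by rewrite !ffunE rmorph_nat addr0 -natrM mulnb andbb.
  move=> w /andP[/andP[/eqP wx /eqP wv]] /eqP[]; apply/rowP => i.
  have [iS|iS] := boolP (i \in S).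
    by have /restrictP := etrans wx (esym vx); apply.
  by have /restrictP := wv; apply; rewrite inE.
rewrite (reindex_inj (addIr t)) -[#|[set v in D | _]|]sum1_card natr_sum /=.
rewrite [LHS]big_mkcond [RHS]big_mkcond; apply: eq_bigr => v _.
rewrite inE restrictD tx tD -[X in _ == X]add0r (inj_eq (addIr x)).
by case: (v \in D); case: eqP.
Qed.

End Restriction.

Lemma exists_superset_card (T : finType) (S : {set T}) r :
  (#|S| <= r <= #|T|)%N -> exists2 S' : {set T}, S \subset S' & #|S'| = r.
Proof.
case/andP=> Sr rT; have [d] := ubnP (r - #|S|); elim: d S Sr => // d IH S Sr lt_d.
have [<-|Sr'] := eqVneq #|S| r; first by exists S.
have [x xS] : exists x, x \notin S.
  apply/existsP; rewrite -negb_forall; apply/negP => /forallP S_all.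
  have ST : S = setT by apply/setP => x; rewrite S_all inE.
  by move: Sr' Sr; rewrite ST cardsT; lia.
have [||S' SS' <-] := IH (x |: S); rewrite ?cardsU1 ?xS; [lia | lia |].
by exists S' => //; apply: subset_trans SS'; apply: subsetUr.
Qed.

(** * The cosets behind the code states, and their distances *)

Section CodeStates.
Variables (F : finFieldType) (k l : nat) (A : 'M[F]_(k, l)) (r1 r2 : 'I_k).
Hypotheses (hr1 : r1.+2 = k) (hr2 : r2.+1 = k).
Hypothesis min_dist : forall a b : 'rV[F]_k, a != b ->
  (l < hamming_dist (row_mx a (a *m A)) (row_mx b (b *m A)))%N.

Let A' : 'M[F]_(k - 2, l) := rowsub (@kept_row k) A.

(** Given by parity checks, so that membership is an equation linear in the pair [(x, m)]. *)
Definition code_coset (m : F * F) : {set 'rV[F]_((k - 2) + l)} :=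
  [set x | rsubmx x ==
           lsubmx x *m A' + (m.1 *: row r1 A + m.2 *: row r2 A)].

Lemma mem_code_coset_row m (u : 'rV[F]_(k - 2)) (v : 'rV[F]_l) :
  (row_mx u v \in code_coset m) =
  (v == u *m A' + (m.1 *: row r1 A + m.2 *: row r2 A)).
Proof. by rewrite inE row_mxKl row_mxKr. Qed.

Lemma code_coset_neq0 m : code_coset m != set0.
Proof.
apply/set0Pn; exists (row_mx 0 (m.1 *: row r1 A + m.2 *: row r2 A)).
by rewrite mem_code_coset_row mul0mx add0r.
Qed.

Lemma code_coset_shift m m' x t :
  t \in code_coset m -> (x + t \in code_coset (m + m')) = (x \in code_coset m').
Proof.
rewrite !inE => /eqP tm; rewrite !linearD /= mulmxDl tm !scalerDl.
rewrite -[in LHS]subr_eq0 -[in RHS]subr_eq0; congr (_ == _).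
rewrite !opprD !addrA; apply/rowP => i; rewrite !mxE; ring.
Qed.

(** The Pauli strings translate labels and fix the first [k - 2] coordinates, so only the summand
    with message [lsubmx x] contributes to the amplitude at [x]. *)
Lemma code_stateE (C : numClosedFieldType) m :
  code_state C A r1 r2 m.1 m.2 = indic C (code_coset m).
Proof.
apply/ffunP => x; rewrite /code_state !pauliXE /psi00 sum_ffunE ffunE.
rewrite G_hat_standard -/A' inE.
rewrite -[x]hsubmxK /M_exponents !scale_row_mx !scaler0 !opp_row_mx !add_row_mx.
rewrite !oppr0 !addr0 row_mxKl row_mxKr.
rewrite (bigD1 (lsubmx x)) //= big1 => [|u ux].
  rewrite ffunE mul_mx_row mulmx1 addr0; congr (nat_of_bool _)%:R.
  rewrite -addrA -opprD; apply/eqP/eqP => [/eq_row_mx[_ <-]|->].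
    by rewrite subrK.
  by rewrite addrK.
rewrite ffunE mul_mx_row mulmx1; case: eqP => // /eq_row_mx[xu _].
by rewrite xu eqxx in ux.
Qed.

(** For [x] in the coset of [m], the codeword of this message under [row_mx 1%:M A] is [x] with the
    two deleted coordinates put back, carrying the values [m.1] and [m.2]. *)
Definition message (m : F * F) (x : 'rV[F]_((k - 2) + l)) : 'rV[F]_k :=
  lsubmx x *m rowsub (@kept_row k) 1%:M +
  (m.1 *: delta_mx 0 r1 + m.2 *: delta_mx 0 r2).

Lemma message_mulmx m x :
  x \in code_coset m -> message m x *m A = rsubmx x.
Proof.
rewrite inE => /eqP ->; rewrite !mulmxDl -!scalemxAl -!rowE.
by rewrite -mulmxA mul_rowsub_mx mul1mx.
Qed.

Lemma message_kept m x i : message m x 0 (kept_row i) = x 0 (lshift l i).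
Proof.
rewrite !mxE (bigD1 i) //= big1 => [|j ji]; rewrite !mxE.
  rewrite !eqxx mulr1 addr0 /= -!val_eqE /= (@ltn_eqF i r1) ?(@ltn_eqF i r2).
  - by rewrite !mulr0 !addr0.
  - by have := ltn_ord i; lia.
  - by have := ltn_ord i; lia.
by rewrite -!val_eqE /= val_eqE (negPf ji) mulr0.
Qed.

Lemma message_r1 m x : message m x 0 r1 = m.1.
Proof.
rewrite !mxE big1 => [|j _]; rewrite ?mxE -?val_eqE ?eqxx /=.
  by rewrite (_ : (r1 == r2 :> nat) = false) ?mulr1 ?mulr0 ?addr0 ?add0r //; lia.
by rewrite ltn_eqF ?mulr0 //; have := ltn_ord j; lia.
Qed.

Lemma message_r2 m x : message m x 0 r2 = m.2.
Proof.
rewrite !mxE big1 => [|j _]; rewrite ?mxE -?val_eqE ?eqxx /=.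
  by rewrite (_ : (r2 == r1 :> nat) = false) ?mulr1 ?mulr0 ?addr0 ?add0r //; lia.
by rewrite ltn_eqF ?mulr0 //; have := ltn_ord j; lia.
Qed.

(** Counting from 0, [r1] is [k - 2] and [r2] is [k - 1], and kept rows lie below both. *)
Lemma ord_kept_case (P : 'I_k -> Prop) :
  (forall i, P (kept_row i)) -> P r1 -> P r2 -> forall i, P i.
Proof.
move=> Pk P1 P2 i; have ik := ltn_ord i.
have [->//|i2] := eqVneq i r2; have [->//|i1] := eqVneq i r1.
have lt_i : (i < k - 2)%N by move: i1 i2; rewrite -!val_eqE /=; lia.
by have := Pk (Ordinal lt_i); congr P; apply: val_inj.
Qed.

(* Deleting two coordinates of the MDS code lowers its distance by at most the
   number of deleted coordinates in which the two codewords differ. *)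
Lemma code_coset_far m m' x y :
  x \in code_coset m -> y \in code_coset m' -> (x, m) != (y, m') ->
  (l < hamming_dist x y + ((m.1 != m'.1) + (m.2 != m'.2)))%N.
Proof.
move=> xm ym' ne; set a := message m x; set b := message m' y.
have ab : a != b.
  apply: contraNneq ne => ab; apply/eqP; congr (_, _).
    rewrite -[x]hsubmxK -[y]hsubmxK.
    rewrite -(message_mulmx xm) -(message_mulmx ym') -/a -/b ab; congr row_mx.
    by apply/rowP => i; rewrite !mxE -(message_kept m) -/a ab message_kept.
  rewrite [m]surjective_pairing [m']surjective_pairing.
  rewrite -(message_r1 m x) -(message_r2 m x) -/a ab.
  by rewrite message_r1 message_r2.
apply: leq_trans (min_dist ab) _.
rewrite (message_mulmx xm) (message_mulmx ym').
(* The full codewords can differ only at the images [E0] of places where [x] and [y] differ, or at a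
   deleted coordinate whose labels differ. *)
pose E1 := if m.1 != m'.1 then [set lshift l r1] else set0.
pose E2 := if m.2 != m'.2 then [set lshift l r2] else set0.
pose E0 := @kept_col k l @: [set i | x 0 i != y 0 i].
have cE1 : #|E1| = (m.1 != m'.1) by rewrite /E1; case: ifP; rewrite ?cards1 ?cards0.
have cE2 : #|E2| = (m.2 != m'.2) by rewrite /E2; case: ifP; rewrite ?cards1 ?cards0.
apply: (@leq_trans #|E0 :|: (E1 :|: E2)|); last first.
  apply: leq_trans (leq_card_setU _ _) _; rewrite leq_add ?leq_imset_card //.
  by rewrite -cE1 -cE2 leq_card_setU.
apply/subset_leq_card/subsetP => i; rewrite !inE.
case: (split_ordP i) => [j ->|j ->]; last first.
  rewrite !row_mxEr !mxE => xy; apply/orP; left; apply/imsetP.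
  exists (rshift _ j); rewrite ?inE // /kept_col.
  by case: split_ordP => j' /eqP; rewrite ?eq_rshift ?eq_rlshift // => /eqP ->.
rewrite !row_mxEl; elim/ord_kept_case: j => [j||].
- rewrite !message_kept => xy; apply/orP; left; apply/imsetP.
  exists (lshift _ j); rewrite ?inE // /kept_col.
  by case: split_ordP => j' /eqP; rewrite ?eq_lshift ?eq_lrshift // => /eqP ->.
- by rewrite !message_r1 /E1 => ->; rewrite inE eqxx orbT.
- by rewrite !message_r2 /E2 => ->; rewrite inE eqxx !orbT.
Qed.

(** Enlarge [S] to a set [T] of size [k - 2]. Codewords agreeing on [T] differ in at most [l]
    places, hence coincide; restriction to [T] is thus an injection between sets of equal size, so
    it is onto. *)
Lemma code_coset_restrict_surj (S : {set 'I_((k - 2) + l)}) (x : 'rV[F]_#|S|) :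
  (#|S| <= k - 2)%N -> exists2 t, restrict S t = x & t \in code_coset 0.
Proof.
move=> Sk; have [T ST cT] : exists2 T : {set 'I_((k - 2) + l)},
    S \subset T & #|T| = (k - 2)%N.
  by apply: exists_superset_card; rewrite Sk card_ord leq_addr.
pose f (u : 'rV[F]_(k - 2)) := restrict T (row_mx u (u *m A')).
have f_code u : row_mx u (u *m A') \in code_coset 0.
  by rewrite mem_code_coset_row !scale0r !addr0.
have f_inj : injective f.
  move=> u v fuv; apply/eqP; apply: contraTT isT => uv.
  have ne : (row_mx u (u *m A'), 0 : F * F) != (row_mx v (v *m A'), 0).
    rewrite xpair_eqE eqxx andbT.
    by apply: contraNneq uv => /eq_row_mx[->].
  have := code_coset_far (f_code u) (f_code v) ne; rewrite !eqxx !addn0.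
  move=> /leq_trans/(_ (hamming_dist_restrict fuv)).
  by rewrite cardsCs setCK cT card_ord addKn ltnn.
have [c cx] := restrict_surj x.
have /codomP[u uc] : restrict T c \in codom f.
  by apply: inj_card_onto => //; rewrite !card_mx cT.
exists (row_mx u (u *m A')) => //; rewrite -cx; apply/restrictP => i iS.
by move/restrictP: uc => -> //; apply: (subsetP ST).
Qed.

End CodeStates.

(** * Diagonal projectors as witnesses for the distance *)

Section DiagonalProjector.
Variables (C : numClosedFieldType) (F : finFieldType) (N : nat).

Lemma wt_le (W : 'End(qudits C F N)) (S : {set 'I_N}) :
  (forall i, i \notin S -> acts_trivially W i) -> (wt W <= #|S|)%N.
Proof.
move=> S_triv; apply/subset_leq_card/subsetP => i; rewrite inE.
by apply: contraNT => /S_triv/asboolP.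
Qed.

Definition diag_proj (g : pred 'rV[F]_N) : 'End(qudits C F N) :=
  op (fun v w => ((v == w) && g w)%:R).

Lemma diag_projE g p v : diag_proj g p v = (g v)%:R * p v.
Proof.
rewrite opE (bigD1 v) //= eqxx big1 ?addr0 // => w wv.
by rewrite eq_sym (negPf wv) mul0r.
Qed.

Lemma acts_trivially_diag_proj (g : pred 'rV[F]_N) (i : 'I_N) :
  (forall v w : 'rV[F]_N, (forall j, j != i -> v 0 j = w 0 j) -> g v = g w) ->
  acts_trivially (diag_proj g) i.
Proof.
move=> g_indep.
(* The missing coordinate [i] is filled with 0, a harmless choice since [g] ignores it. *)
pose ext (v : 'rV[F]_N.-1) : 'rV[F]_N :=
  \row_j if unlift i j is Some j' then v 0 j' else 0.
exists (op (fun v w => ((v == w) && g (ext w))%:R)) => v w.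
rewrite !elt_op -natrM mulnb andbA (g_indep (ext (col' i w)) w) => [|j ji].
  congr (_ && _)%:R; apply/eqP/andP => [->//|[/eqP vwi /eqP vw]].
  apply/rowP => j; have [->//|ji] := eqVneq j i.
  exact: (col'_eq vw).
rewrite mxE; case: unliftP ji => [j' ->|->]; first by rewrite mxE.
by rewrite eqxx.
Qed.

(** Equal norms make [p + q] and [p - q] orthogonal, while [W] sends [p - q] to [p], which overlaps
    [p + q]. *)
Lemma maps_orthogonal_proj (Q : {vspace qudits C F N})
    (W : 'End(qudits C F N)) p q :
  p \in Q -> q \in Q -> dot p q = 0 -> dot q p = 0 -> dot p p = dot q q ->
  dot p p != 0 -> W p = p -> W q = 0 -> maps_orthogonal Q W.
Proof.
move=> pQ qQ pq qp pp pp0 Wp Wq.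
exists (p + q), (p - q); split; rewrite ?rpredB ?rpredD //.
  by rewrite dotBr !dotDl pq qp addr0 add0r pp subrr.
by rewrite linearB /= Wp Wq subr0 dotDl qp addr0.
Qed.

End DiagonalProjector.

(** * Uniformity and code parameters from the MDS distance *)

Section MDSCode.
Variables (F : finFieldType) (k l : nat) (A : 'M[F]_(k, l)) (r1 r2 : 'I_k).
Hypotheses (hr1 : r1.+2 = k) (hr2 : r2.+1 = k) (hk : (3 <= k)%N) (hkl : (k <= l)%N).
Hypothesis min_dist : forall a b : 'rV[F]_k, a != b ->
  (l < hamming_dist (row_mx a (a *m A)) (row_mx b (b *m A)))%N.

Let D := code_coset A r1 r2.
Let far := code_coset_far hr1 hr2 min_dist.
Let restrict_surj := code_coset_restrict_surj hr1 hr2 min_dist.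

Lemma code_coset_uniform (C : numClosedFieldType) m :
  uniform_state (indic C (D m)) (k - 2).
Proof.
apply: uniform_indic; first exact: code_coset_neq0.
  move=> x y xm ym xy; have := far xm ym.
  by rewrite xpair_eqE negb_and xy !eqxx !addn0 => /(_ isT); lia.
move=> S x /(restrict_surj x)[t tx t0]; exists t => // v.
by rewrite -[in LHS](add0r m) code_coset_shift.
Qed.

(** The two deleted coordinates cost at most 2, leaving [l + 1 - 2], and [k <= l]. *)
Lemma code_coset_far_lb m m' x y : x \in D m -> y \in D m' ->
  (x, m) != (y, m') -> (k - 1 <= hamming_dist x y)%N.
Proof.
move=> xm ym' /(far xm ym').
by case: (m.1 != m'.1); case: (m.2 != m'.2); lia.
Qed.

(** Any [c] in the coset of [m' - m] translates correctly; subtracting an element of the zero coset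
    that agrees with [c] on [S] makes it vanish there. *)
Lemma code_coset_translate m m' (S : {set 'I_((k - 2) + l)}) :
  (#|S| < k - 1)%N ->
  exists2 t : 'rV[F]_((k - 2) + l), forall i, i \in S -> t 0 i = 0 &
    forall x, (x + t \in D m') = (x \in D m).
Proof.
move=> Sk; have [c cD] := set0Pn _ (code_coset_neq0 A r1 r2 (m' - m)).
have [|z zc z0] := @restrict_surj S (restrict S c); first by lia.
exists (c - z) => [i iS|x].
  by move/restrictP: zc => /(_ i iS) zc; rewrite !mxE zc subrr.
rewrite -(code_coset_shift m' _ z0) add0r -addrA subrK.
by rewrite -[in LHS](subrK m m') code_coset_shift.
Qed.

(** Otherwise the codeword of the unit message at [r1] would have weight 1, yet nonzero codewords
    have weight above [l]. *)
Lemma row_r1_neq0 : exists j, A r1 j != 0.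
Proof.
apply/existsP; rewrite -negb_forall; apply/negP => /forallP A0.
have ne : delta_mx 0 r1 != 0 :> 'rV[F]_k.
  by apply/eqP => /rowP/(_ r1)/eqP; rewrite !mxE !eqxx oner_eq0.
have := min_dist ne; rewrite -rowE mul0mx.
have -> : row r1 A = 0 by apply/rowP => j; rewrite !mxE; apply/eqP.
rewrite ltnNge => /negP[]; apply: (@leq_trans #|[set lshift l r1]|).
  2: by rewrite cards1; lia.
apply/subset_leq_card/subsetP => i.
rewrite !inE; case: (split_ordP i) => i' ->; rewrite ?row_mxEl ?row_mxEr !mxE.
  by rewrite eq_lshift !eqxx; case: (i' == r1) => //=; rewrite mulr0n eqxx.
by rewrite eqxx.
Qed.

(* Measuring one parity check of the code of |psi_00>, on the k - 2 message
   coordinates and one more coordinate, separates |psi_00> from |psi_10>. *)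
Lemma code_detecting_op (C : numClosedFieldType) :
  exists2 W, maps_orthogonal <<[seq indic C (D m) | m : F * F]>>%VS W
    & (wt W <= k - 1)%N.
Proof.
have [j Aj] := row_r1_neq0.
pose g (v : 'rV[F]_((k - 2) + l)) :=
  v 0 (rshift _ j) == (lsubmx v *m rowsub (@kept_row k) A) 0 j.
have st_Q m : indic C (D m) \in <<[seq indic C (D m) | m : F * F]>>%VS.
  by apply/memv_span/image_f.
have k_gt0 : (0 < k - 1)%N by lia.
have orth m m' : m != m' -> dot (indic C (D m)) (indic C (D m')) = 0.
  exact: indic_orthogonal k_gt0 code_coset_far_lb m m'.
(* On a coset the defect of parity check [j] depends only on [m]: it is 0 for [(0, 0)] and [A r1 j]
   for [(1, 0)]. *)
have gD m v : v \in D m -> g v = (m.1 * A r1 j + m.2 * A r2 j == 0).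
  rewrite inE /g => /eqP/rowP/(_ j); rewrite mxE => ->.
  by rewrite mxE -subr_eq0 addrAC subrr add0r !mxE.
have ne : (0, 0) != (1, 0) :> F * F by rewrite xpair_eqE eq_sym oner_eq0.
exists (diag_proj C g).
  apply: (maps_orthogonal_proj (st_Q (0, 0)) (st_Q (1, 0))).
  - exact: orth.
  - by apply: orth; rewrite eq_sym.
  - rewrite !dot_indic_card !setIid.
    by rewrite (card_indic k_gt0 code_coset_translate (0, 0) (1, 0)).
  - by rewrite dot_indic_card setIid pnatr_eq0 cards_eq0 code_coset_neq0.
  - apply/ffunP => v; rewrite diag_projE !ffunE.
    have [/gD->|] := boolP (v \in D _); last by rewrite mulr0.
    by rewrite !mul0r addr0 eqxx mul1r.
  - apply/ffunP => v; rewrite diag_projE !ffunE.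
    have [/gD->|] := boolP (v \in D _); last by rewrite mulr0.
    by rewrite mul0r addr0 mul1r (negPf Aj) mul0r.
(* The predicate [g] reads only these coordinates. *)
pose S := rshift (k - 2) j |: [set lshift l i | i : 'I_(k - 2)].
apply: (@leq_trans #|S|); last first.
  rewrite cardsU1 (_ : k - 1 = 1 + (k - 2))%N; last by lia.
  by rewrite leq_add ?leq_b1 // (leq_trans (leq_imset_card _ _)) ?card_ord.
apply: wt_le => i iS; apply: acts_trivially_diag_proj => v w vw.
have vwS s : s \in S -> v 0 s = w 0 s.
  by move=> sS; apply: vw; apply: contraNneq iS => <-.
rewrite /g vwS ?setU11 //; congr (_ == (_ *m _) 0 j); apply/rowP => s.
by rewrite !mxE vwS // setU1r // imset_f.
Qed.

Lemma code_coset_qecc (C : numClosedFieldType) :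
  qecc <<[seq indic C (D m) | m : F * F]>>%VS ((k - 2) + l) 2 (k - 1).
Proof.
apply: qecc_indic; first by lia.
- by rewrite card_prod mulnn.
- exact: code_coset_neq0.
- exact: code_coset_far_lb.
- exact: code_coset_translate.
- exact: code_detecting_op.
Qed.

End MDSCode.

(* Imported last: [complex] defines another [restrict]. *)
From mathcomp Require Import reals complex.

(* r1 and r2 are the (k-1)-th and k-th rows, counting from 1. *)
Theorem mainTheorem3 (R : realType) (F : finFieldType) (k n : nat)
    (hk : (3 <= k)%N) (hkn : (k <= n./2)%N) (A : 'M[F]_(k, n - k))
    (hA : generates_MDS (row_mx 1%:M A) n k)
    (r1 r2 : 'I_k) (hr1 : r1.+2 = k) (hr2 : r2.+1 = k) :
  let psi (m : F * F) : qudits R[i] F ((k - 2) + (n - k)) :=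
    code_state R[i] A r1 r2 m.1 m.2 in
  [/\ forall m m' : F * F, m != m' -> dot (psi m) (psi m') = 0,
      forall m : F * F, uniform_state (psi m) (k - 2)
    & qecc <<[seq psi m | m : F * F]>>%VS (n - 2) 2 (k - 1)].
Proof.
(* The identity block makes distinct messages give distinct codewords, to which the MDS distance
   [n - k + 1] applies. *)
have min_dist (a b : 'rV[F]_k) : a != b ->
    (n - k < hamming_dist (row_mx a (a *m A)) (row_mx b (b *m A)))%N.
  have [_ _ _ [_ dist_ge]] := hA.
  have rowE c : row_mx c (c *m A) = c *m row_mx 1%:M A.
    by rewrite mul_mx_row mulmx1.
  move=> ab; apply: (@leq_trans (n - k + 1)); first by rewrite addn1.
  apply: dist_ge; rewrite ?rowE ?submxMl // -!rowE.
  by apply: contraNneq ab => /eq_row_mx[->].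
have hkl : (k <= n - k)%N by move: hkn; rewrite geq_half_double; lia.
move=> psi.
have psiE m : psi m = indic R[i] (code_coset A r1 r2 m) by exact: code_stateE.
split=> [m m' mm'|m|].
- rewrite !psiE; have k_gt0 : (0 < k - 1)%N by lia.
  exact: (indic_orthogonal _ k_gt0 (code_coset_far_lb hr1 hr2 hk hkl min_dist)).
- by rewrite psiE; apply: code_coset_uniform.
have -> : (n - 2 = (k - 2) + (n - k))%N by lia.
have -> : [seq psi m | m : F * F] = [seq indic R[i] (code_coset A r1 r2 m) | m : F * F].
  exact: eq_map.
exact: code_coset_qecc.
Qed.
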